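(* Let $k$ be a difference field of characteristic $0$, $R=k\{y_1,\ldots,y_n\}$, $S\subseteq\mathbb{N}[x]^n$, and $I=\langle \mathbf{y}^{\mathbf{u}}:\mathbf{u}\in S\rangle_r$. Then there exist $\mathbf{b}_1,\ldots,\mathbf{b}_s\in(\mathbb{N}\cup\{-1\})^n$ such that \[I=\mathfrak{m}^{\mathbf{b}_1}\cap\cdots\cap\mathfrak{m}^{\mathbf{b}_s}.\] Moreover, if such a decomposition is irredundant, then it is unique (i.e. any two irredundant decompositions of this form have the same set of intersectands).
   Context: A difference field is a field $k$ with a ring endomorphism $\sigma$. $R=k\{y_1,\ldots,y_n\}$ is the polynomial ring over $k$ in the variables $\sigma^j(y_i)$ ($1\le i\le n$, $j\ge0$), with $\sigma$ extended naturally. For $p=\sum_i c_ix^i\in\mathbb{N}[x]$ and $a\in R$, $a^p=\prod_i(\sigma^i(a))^{c_i}$; for $\mathbf{u}\in\mathbb{N}[x]^n$, $\mathbf{y}^{\mathbf{u}}=y_1^{u_1}\cdots y_n^{u_n}$. A $\sigma$-ideal is an ideal $I$ with $\sigma(I)\subseteq I$; it is well-mixed if $ab\in I$ implies $a\sigma(b)\in I$. $\langle F\rangle_r$ denotes the smallest radical well-mixed $\sigma$-ideal containing $F$. For $\mathbf{b}=(b_1,\ldots,b_n)\in(\mathbb{N}\cup\{-1\})^n$, $\mathfrak{m}^{\mathbf{b}}$ is the $\sigma$-ideal generated by $\{\sigma^{b_i}(y_i): b_i\neq -1\}$ (i.e. by $y_i^{x^{b_i}}$ for $b_i\ne-1$).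 *)

(* Defs.v *)
From HB Require Import structures.
From mathcomp Require Import all_boot all_algebra.
From mathcomp Require Import finmap.
From mathcomp.multinomials Require Import monalg.

Set Implicit Arguments.
Unset Strict Implicit.
Unset Printing Implicit Defensive.

Import GRing.Theory.
Local Open Scope ring_scope.

(* Difference polynomial ring k{y_1,...,y_n}: the commutative polynomial
   ring over k in the variables sigma^j(y_i), indexed by (i, j) : 'I_n * nat. *)
Definition dvar (n : nat) : choiceType := ('I_n * nat)%type.

Definition dpoly (k : fieldType) (n : nat) := {malg k[cmonom (dvar n)]}.

Definition dX (k : fieldType) (n : nat) (i : 'I_n) (j : nat) : dpoly k n :=
  << (1 : k) *g ucm ((i, j) : dvar n) >>.

Definition dsig (k : fieldType) (sigma : {rmorphism k -> k}) (n : nat)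
    (a : dpoly k n) : dpoly k n :=
  mmap (fun c : k => (sigma c)%:MP)
    (fun m : cmonom (dvar n) =>
       \prod_(v <- finsupp m) dX k v.1 v.2.+1 ^+ m v) a.

Definition dpow (k : fieldType) (sigma : {rmorphism k -> k}) (n : nat)
    (a : dpoly k n) (p : {poly nat}) : dpoly k n :=
  \prod_(j < size p) (iter j (@dsig k sigma n) a) ^+ (nth 0%N p j).

Definition dmon (k : fieldType) (sigma : {rmorphism k -> k}) (n : nat)
    (u : 'I_n -> {poly nat}) : dpoly k n :=
  \prod_(i < n) dpow sigma (dX k i 0) (u i).

Definition is_ideal (k : fieldType) (n : nat) (I : dpoly k n -> Prop) :=
  [/\ I 0, (forall a b, I a -> I b -> I (a + b)) &
      (forall r a, I a -> I (r * a))].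

Definition is_sigma_ideal (k : fieldType) (sigma : {rmorphism k -> k})
    (n : nat) (I : dpoly k n -> Prop) :=
  is_ideal I /\ (forall a, I a -> I (dsig sigma a)).

Definition is_well_mixed (k : fieldType) (sigma : {rmorphism k -> k})
    (n : nat) (I : dpoly k n -> Prop) :=
  forall a b, I (a * b) -> I (a * dsig sigma b).

Definition is_radical (k : fieldType) (n : nat) (I : dpoly k n -> Prop) :=
  forall a (e : nat), I (a ^+ e) -> I a.

Definition sigma_gen (k : fieldType) (sigma : {rmorphism k -> k}) (n : nat)
    (F : dpoly k n -> Prop) : dpoly k n -> Prop :=
  fun a => forall J, is_sigma_ideal sigma J -> (forall f, F f -> J f) -> J a.

Definition rwm_gen (k : fieldType) (sigma : {rmorphism k -> k}) (n : nat)
    (F : dpoly k n -> Prop) : dpoly k n -> Prop :=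
  fun a => forall J, is_sigma_ideal sigma J -> is_well_mixed sigma J ->
    is_radical J -> (forall f, F f -> J f) -> J a.

(* m^b, with b : 'I_n -> option nat; None encodes the value -1. *)
Definition mideal (k : fieldType) (sigma : {rmorphism k -> k}) (n : nat)
    (b : 'I_n -> option nat) : dpoly k n -> Prop :=
  sigma_gen sigma
    (fun f => exists i j, b i = Some j /\ f = iter j (@dsig k sigma n) (dX k i 0)).

Definition ideal_eq (k : fieldType) (n : nat) (I J : dpoly k n -> Prop) :=
  forall a, I a <-> J a.

(* Intersection m^{b_1} cap ... cap m^{b_s} (the whole ring when s = 0). *)
Definition mcap (k : fieldType) (sigma : {rmorphism k -> k}) (n s : nat)
    (bs : 'I_s -> 'I_n -> option nat) : dpoly k n -> Prop :=
  fun a => forall t, mideal sigma (bs t) a.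

Definition irredundant (k : fieldType) (sigma : {rmorphism k -> k}) (n s : nat)
    (bs : 'I_s -> 'I_n -> option nat) :=
  forall t : 'I_s,
    ~ ideal_eq (fun a => forall t', t' != t -> mideal sigma (bs t') a)
               (mcap sigma bs).

(* Main.v *)
Require Import Defs.
From HB Require Import structures.
From mathcomp Require Import all_boot all_algebra.
From mathcomp Require Import finmap.
From mathcomp.multinomials Require Import monalg.
From Stdlib Require Import Classical.

(** A monomial ideal m^b is generated by variables, hence prime; being a
    sigma-ideal it is therefore radical and well-mixed, and so is every
    intersection of such ideals.  Conversely, in a radical well-mixed
    sigma-ideal each factor sigma^j(y_i) of a monomial may be raised to
    sigma^t(y_i), t >= j, and multiplicities may be dropped: membership of a
    monomial m only depends on its height, the vector whose i-th entry is
    1 + the largest order of y_i in m (0 when y_i does not occur), and the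
    heights that occur form the up-set generated by those of the y^u.  By
    Dickson's lemma this up-set is a finite intersection of unions of
    half-spaces {h | b_i < h_i}, that is, of height sets of ideals m^b.
    Uniqueness is that of irredundant intersections of primes. *)

Set Implicit Arguments.
Unset Strict Implicit.
Unset Printing Implicit Defensive.

Import GRing.Theory.

(* Kronecker's substitution: a monomial is read as a number in base [B], its
   exponents along [s] being the digits. *)
Section Kronecker.
Variables (I : choiceType) (s : seq I) (B : nat).
Implicit Types m : cmonom I.

Definition kweight m : nat := foldr (fun v acc => m v + B * acc) 0 s.

Lemma kweight1 : kweight mone = 0.
Proof. by rewrite /kweight; elim: s => //= v r ->; rewrite cm1 muln0. Qed.

Lemma kweightM m1 m2 : kweight (mmul m1 m2) = (kweight m1 + kweight m2).
Proof.
rewrite /kweight; elim: s => //= v r ->.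
by rewrite cmM mulnDr addnACA.
Qed.

Lemma kweight_inj m1 m2 :
  (forall v, v \in s -> m1 v < B) -> (forall v, v \in s -> m2 v < B) ->
  kweight m1 = kweight m2 -> {in s, m1 =1 m2}.
Proof.
rewrite /kweight; elim: s => //= v r IHr lt1 lt2 eqw.
have [lt1v lt2v] : (m1 v < B) /\ (m2 v < B).
  by split; [apply: lt1 | apply: lt2]; rewrite mem_head.
have B_gt0 : (0 < B) by apply: leq_ltn_trans lt1v.
have eqv : m1 v = m2 v.
  move/(congr1 (modn^~ B)): eqw.
  by rewrite ![_ + B * _]addnC ![B * _]mulnC !modnMDl !modn_small.
move=> u; rewrite inE => /predU1P[->//|]; apply: IHr.
- by move=> w wr; apply: lt1; rewrite inE wr orbT.
- by move=> w wr; apply: lt2; rewrite inE wr orbT.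
by move/eqP: eqw; rewrite eqv eqn_add2l eqn_pmul2l // => /eqP.
Qed.

End Kronecker.

(** [s] lists every variable met in [ms] and [B] exceeds every exponent; a variable repeated in [s]
    only repeats a digit. *)
Lemma kweight_separates (I : choiceType) (ms : seq (cmonom I)) :
  exists s B, {in ms &, injective (@kweight I s B)}.
Proof.
pose s := flatten (map (fun m : cmonom I => finsupp m : seq I) ms).
pose B := (\max_(m <- ms) \max_(v <- s) m v).+1.
exists s, B => m1 m2 m1ms m2ms eqw.
have ltB m : m \in ms -> forall v, v \in s -> (m v < B).
  move=> mms v vs; rewrite ltnS.
  apply: (@leq_trans (\max_(v <- s) m v)).
    exact: (@leq_bigmax_seq I s xpredT (fun v => m v)).
  exact: (@leq_bigmax_seq _ ms xpredT (fun m : cmonom I => \max_(v <- s) m v)).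
have eqs := kweight_inj (ltB _ m1ms) (ltB _ m2ms) eqw.
apply/eqP/cmP => v; have [/eqs//|vNs] := boolP (v \in s).
have z m : m \in ms -> m v = 0.
  move=> mms; apply/eqP; rewrite cmE_eq0; apply: contra vNs => vm.
  by apply/flattenP; exists (finsupp m : seq I) => //; apply: map_f.
by rewrite !z.
Qed.

(** * Dickson's lemma and up-sets *)

Lemma fin_uniform_bound (T : finType) (P : T -> nat -> Prop) :
  (forall x a b, a <= b -> P x a -> P x b) -> (forall x, exists a, P x a) ->
  exists a, forall x, P x a.
Proof.
move=> Pmono /fin_all_exists[a Pa]; exists (\max_x a x) => x.
exact: Pmono (leq_bigmax x) (Pa x).
Qed.

(** Induction on the coordinates. The inductive hypothesis controls everything but the
    [a]-coordinate, which is handled by comparing [d a] with a threshold [V]. *)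
Lemma dickson_on (T : finType) (A : seq T) (D : (T -> nat) -> Prop) :
  exists N, forall d, D d -> exists c,
    [/\ D c, {in A, forall i, c i <= d i} & {in A, forall i, c i <= N}].
Proof.
elim: A D => [|a A IH] D; first by exists 0 => d Dd; exists d.
have [N HN] := IH D.
(* Patterns on [A] bounded by [N] are finitely many, so one [V] bounds the [a]-coordinate of some
   realization of each realizable pattern. *)
have [V HV] : exists V, forall r : {ffun T -> 'I_N.+1},
    (exists2 c, D c & {in A, forall i, c i = r i}) ->
    exists c, [/\ D c, {in A, forall i, c i = r i} & c a <= V].
  apply: fin_uniform_bound => [r V V' leV H /H[c [Dc cr ca]]|r].
    by exists c; split => //; apply: leq_trans leV.
  case: (classic (exists2 c, D c & {in A, forall i, c i = r i})) => [[c Dc cr]|No].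
    by exists (c a) => _; exists c.
  by exists 0.
(* For [d a] at most [V], the inductive hypothesis is applied to the finitely many slices
   [d a <= v]. *)
have [M HM] : exists M, forall v : 'I_V.+1, forall d, D d -> d a <= v ->
    exists c, [/\ D c, c a <= v, {in A, forall i, c i <= d i}
                & {in A, forall i, c i <= M}].
  apply: fin_uniform_bound => [v M M' leM H d Dd da|v].
    have [c [Dc ca cd cM]] := H d Dd da; exists c; split=> // i /cM cMi.
    exact: leq_trans leM.
  have [M HM] := IH (fun d => D d /\ d a <= v).
  by exists M => d Dd da; have [c [[Dc ca] cd cM]] := HM d (conj Dd da); exists c.
exists (maxn V (maxn N M)) => d Dd; case: (leqP (d a) V) => [da|/ltnW da].
  have [c [Dc ca cd cM]] := HM (Ordinal (da : d a < V.+1)) d Dd (leqnn _).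
  exists c; split=> // i; rewrite inE => /predU1P[->//|iA]; first exact: cd.
    by rewrite leq_max (leq_trans ca).
  by rewrite !leq_max cM ?orbT.
(* Here [d a] exceeds [V]: [c0] is replaced by a realization of its pattern with [a]-coordinate at
   most [V]. *)
have [c0 [Dc0 c0d c0N]] := HN d Dd.
have [|c [Dc cr ca]] := HV [ffun i => inord (minn (c0 i) N)].
  exists c0 => // i iA; rewrite ffunE inordK ?ltnS ?geq_minr //.
  by apply/esym/minn_idPl/c0N.
have cc0 : {in A, c =1 c0}.
  move=> i iA; rewrite cr // ffunE inordK ?ltnS ?geq_minr //.
  exact/minn_idPl/c0N.
exists c; split=> // i; rewrite inE => /predU1P[->//|iA].
- exact: leq_trans da.
- by rewrite cc0 // c0d.
- by rewrite leq_max ca.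
by rewrite !leq_max cc0 // c0N ?orbT.
Qed.

Lemma dickson (T : finType) (D : (T -> nat) -> Prop) :
  exists N, forall d, D d -> exists c,
    [/\ D c, forall i, c i <= d i & forall i, c i <= N].
Proof.
have [N HN] := dickson_on (enum T) D.
exists N => d /HN[c [Dc cd cN]]; exists c.
by split=> // i; [apply: cd | apply: cN]; rewrite mem_enum.
Qed.

Lemma finType_family (T : finType) (P : T -> Prop) :
  exists s (e : 'I_s -> T), forall x, P x <-> exists t, e t = x.
Proof.
have /fin_all_exists[p Pp] : forall x, exists b : bool, P x <-> b.
  by move=> x; case: (classic (P x)); [exists true | exists false].
exists #|p|, enum_val => x; split=> [/Pp px|[t <-]].
  by exists (enum_rank_in px x); rewrite enum_rankK_in.
by apply/Pp; apply: enum_valP.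
Qed.

(** Take all [b] with entries below the Dickson bound [N] whose union of half-spaces contains [D]:
    they are finitely many, and any [h] outside the up-set of [D] violates one of them. *)
Lemma upset_decomposition (T : finType) (D : (T -> nat) -> Prop) :
  exists s (bs : 'I_s -> T -> option nat),
  (forall t d, D d -> exists i j, bs t i = Some j /\ j < d i) /\
  (forall h, (forall t, exists i j, bs t i = Some j /\ j < h i) ->
     exists2 d, D d & forall i, d i <= h i).
Proof.
have [N HN] := dickson D.
pose b_of (b : {ffun T -> option 'I_N}) i := omap (@nat_of_ord N) (b i).
have [s [e He]] := finType_family (fun b : {ffun T -> option 'I_N} =>
  forall d, D d -> exists i j, b_of b i = Some j /\ j < d i).
exists s, (fun t => b_of (e t)); split=> [t|h Hh].
  by apply/He; exists t.
(* Separates [h] from the up-set: only the coordinates below [N] matter. *)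
pose b : {ffun T -> option 'I_N} := [ffun i => insub (h i)].
have b_h i j : b_of b i = Some j -> j = h i.
  by rewrite /b_of ffunE; case: insubP => //= k _ <- [].
apply: NNPP => No.
have /He[t et] : forall d, D d -> exists i j, b_of b i = Some j /\ j < d i.
  move=> d Dd; have [c [Dc cd cN]] := HN d Dd.
  (* Since [c] is not below [h], some [h i < c i <= N], which puts the threshold [h i] in range. *)
  have [i hc] : exists i, h i < c i.
    apply: NNPP => Nc; apply: No; exists c => // i; rewrite leqNgt; apply/negP.
    by move=> hc; apply: Nc; exists i.
  exists i, (h i); split; last exact: leq_trans (cd i).
  by rewrite /b_of ffunE insubT //; apply: leq_trans (cN i).
have [i [j []]] := Hh t; rewrite et => /b_h ->; by rewrite ltnn.
Qed.

Local Open Scope ring_scope.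

(** * Ideals generated by variables are prime *)

Section VarIdeal.
Variables (I : choiceType) (R : idomainType) (V : pred I).
Implicit Types (m : cmonom I) (f g : {malg R[cmonom I]}).

(** The ideal generated by the variables in [V], described by supports so that membership is tested
    monomial by monomial. *)
Definition var_ideal f := forall m, m \in msupp f -> has V (finsupp m).

Lemma has_finsuppM m1 m2 :
  has V (finsupp (mmul m1 m2)) = has V (finsupp m1) || has V (finsupp m2).
Proof.
rewrite mdomD; apply/hasP/orP => [[v]|].
  by rewrite in_fsetU => /orP[] vm Vv; [left|right]; apply/hasP; exists v.
by case=> /hasP[v vm Vv]; exists v; rewrite // in_fsetU vm ?orbT.
Qed.

Lemma var_ideal0 : var_ideal 0.
Proof. by move=> m; rewrite msupp0. Qed.

Lemma var_idealD f g : var_ideal f -> var_ideal g -> var_ideal (f + g).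
Proof.
move=> Vf Vg m /(fsubsetP (msuppD_le _ _)).
by rewrite in_fsetU => /orP[/Vf|/Vg].
Qed.

Lemma var_idealM f g : var_ideal g -> var_ideal (f * g).
Proof.
move=> Vg m /msuppM_le[m1 [m2 [_ /Vg Vm ->]]].
by rewrite has_finsuppM Vm orbT.
Qed.

Lemma var_idealU m : var_ideal << m >> <-> has V (finsupp m).
Proof.
split=> [|Vm m']; first by apply; rewrite msuppU1 in_fset1.
by rewrite msuppU1 in_fset1 => /eqP->.
Qed.

Lemma var_ideal_proper : ~ var_ideal 1.
Proof. by move/(_ mone); rewrite msuppU1 in_fset1 eqxx mdom1 => /(_ isT). Qed.

(* The variables in [V] go to [0], the others to powers of ['X]: for a suitable
   base this ring morphism into a domain separates two given elements from
   the ideal generated by [V]. *)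
Definition kmon s B m : {poly R} :=
  if has V (finsupp m) then 0 else 'X^(kweight s B m).

Fact kmon_is_mmorphism s B : mmorphism (kmon s B).
Proof.
split=> [m1 m2|]; last by rewrite /kmon mdom1 kweight1.
rewrite /kmon has_finsuppM kweightM exprD.
by do 2!case: has; rewrite ?mul0r ?mulr0.
Qed.
HB.instance Definition _ s B := isMultiplicative.Build _ _ (kmon s B)
  (kmon_is_mmorphism s B).

Definition ksubst s B : {malg R[cmonom I]} -> {poly R} := mmap polyC (kmon s B).

Lemma ksubst0 s B f : var_ideal f -> ksubst s B f = 0.
Proof.
move=> Vf; rewrite /ksubst mmapE big_seq big1 // => m /Vf Vm.
by rewrite /kmon Vm mulr0.
Qed.

(** A monomial of [f] free of [V] keeps its coefficient in the image: no other monomial of [f] has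
    the same weight, so nothing cancels. *)
Lemma ksubst_neq0 s B f : {in msupp f &, injective (@kweight I s B)} ->
  ~ var_ideal f -> ksubst s B f != 0.
Proof.
move=> inj_w NVf; apply/eqP => f0; apply: NVf => m mf.
apply: contraT => NVm; move/(congr1 (fun p : {poly R} => p`_(kweight s B m))): f0.
rewrite /ksubst mmapE coef_sum coef0 (big_fsetD1 m) //= big_seq big1 => [|m'].
  rewrite /kmon (negPf NVm) coefCM coefXn eqxx mulr1 addr0 => /eqP.
  by rewrite mcoeff_eq0 mf.
rewrite in_fsetD1 => /andP[m'm m'f]; rewrite coefCM /kmon.
case: has; first by rewrite coef0 mulr0.
rewrite coefXn; case: eqP => [eqw|]; last by rewrite mulr0.
by rewrite (inj_w _ _ mf m'f eqw) eqxx in m'm.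
Qed.

Lemma var_ideal_prime f g : var_ideal (f * g) -> var_ideal f \/ var_ideal g.
Proof.
move=> Vfg; apply: NNPP => /not_or_and[NVf NVg].
(* One base serves both supports: the same morphism keeps [f] and [g] nonzero but kills their
   product. *)
have [s [B inj_w]] := kweight_separates ((msupp f : seq _) ++ msupp g).
have := ksubst0 s B Vfg; rewrite /ksubst rmorphM.
apply/eqP; rewrite mulf_neq0 // ksubst_neq0 //.
  by move=> m1 m2 m1f m2f; apply: inj_w; rewrite mem_cat ?m1f ?m2f.
by move=> m1 m2 m1f m2f; apply: inj_w; rewrite mem_cat ?m1f ?m2f orbT.
Qed.

End VarIdeal.

Lemma malgU_divisible (I : choiceType) (R : comNzRingType) (v : I) (m : cmonom I) :
  v \in finsupp m ->
  (<< m >> : {malg R[cmonom I]}) = << divcm m (ucm v) >> * << ucm v >>.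
Proof.
move=> vm; rewrite malgM_def fgmulUU mulr1; congr (<< _ >>).
apply/eqP/cmP => w; rewrite mulcmE divcmE cmU subnK //.
by case: eqP => // <-; rewrite lt0n cmE_neq0.
Qed.

(** * The ideals m^b of the difference polynomial ring *)

Section Difference.
Variables (k : fieldType) (sigma : {rmorphism k -> k}) (n : nat).
Implicit Types (K : dpoly k n -> Prop) (b : 'I_n -> option nat).
Implicit Types (m : cmonom (dvar n)) (f g : dpoly k n).

Lemma ideal_msupp K f : is_ideal K ->
  (forall m, m \in msupp f -> K << m >>) -> K f.
Proof.
case=> K0 KD KM Kf; rewrite (monalgE f) big_seq.
elim/big_rec: _ => [|m g mf Kg]; first exact: K0.
apply: KD Kg; have -> : << f@_m *g m >> = (f@_m)%:MP * << m >>.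
  by rewrite malgM_def fgmulUU mulr1 mul1m.
exact/KM/Kf.
Qed.

Lemma dsig_dX (i : 'I_n) j : dsig sigma (dX k i j) = dX k i j.+1.
Proof.
rewrite /dsig mmapE /dX msuppU1 big_seq_fset1 mcoeffUU rmorph1.
by rewrite mdomU big_seq_fset1 cmUU expr1 mpolyC1E mul1r.
Qed.

Lemma iter_dsig_dX (i : 'I_n) j t :
  iter t (@dsig k sigma n) (dX k i j) = dX k i (j + t).
Proof.
elim: t => [|t /= ->]; first by rewrite addn0.
by rewrite dsig_dX addnS.
Qed.

(** The variables lying in m^b: all transforms of its generators. They generate m^b as a plain
    ideal. *)
Definition bvar b : pred (dvar n) :=
  fun v => if b v.1 is Some j then (j <= v.2)%N else false.

Lemma var_ideal_dX b i j t : b i = Some j -> (j <= t)%N ->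
  var_ideal (bvar b) (dX k i t).
Proof.
move=> bi jt; apply/var_idealU/hasP; exists (i, t).
  by rewrite mdomU in_fset1.
by rewrite /bvar /= bi.
Qed.

Lemma var_ideal_ideal (V : pred (dvar n)) : is_ideal (@var_ideal _ k V).
Proof.
split; [exact: var_ideal0 | exact: var_idealD | exact: var_idealM].
Qed.

Lemma var_ideal_sigma b : is_sigma_ideal sigma (@var_ideal _ k (bvar b)).
Proof.
split=> [|f Vf]; first exact: var_ideal_ideal.
have [V0 VD VM] := var_ideal_ideal (bvar b).
rewrite /dsig mmapE big_seq; apply: (big_ind _ V0 VD) => m /Vf/hasP[v vm Vv].
apply: (VM); rewrite (big_fsetD1 v) //= mulrC; apply: (VM).
rewrite -(prednK (n := m v)) ?lt0n ?cmE_neq0 // exprSr; apply: (VM).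
move: Vv; rewrite /bvar; case bv: (b v.1) => [j|] // jv.
exact: var_ideal_dX bv (leqW jv).
Qed.

Lemma mideal_var b f : mideal sigma b f <-> var_ideal (bvar b) f.
Proof.
split=> [|Vf J [Jideal Jsig] JX].
  apply; first exact: var_ideal_sigma.
  move=> _ [i [j [bi ->]]]; rewrite iter_dsig_dX add0n.
  exact: var_ideal_dX bi (leqnn j).
apply: ideal_msupp => // m /Vf/hasP[[i t] vm].
rewrite /bvar /=; case bi: (b i) => [j|] // jt.
rewrite (malgU_divisible _ vm); case: (Jideal) => _ _; apply.
have -> : << ucm ((i, t) : dvar n) >> = iter (t - j) (@dsig k sigma n) (dX k i j).
  by rewrite iter_dsig_dX subnKC.
have Jj : J (dX k i j).
  by apply: JX; exists i, j; split=> //; rewrite iter_dsig_dX add0n.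
by elim: (t - j)%N => //= e; apply: Jsig.
Qed.

Lemma mideal_sigma_ideal b : is_sigma_ideal sigma (mideal sigma b).
Proof.
have [[V0 VD VM] Vs] := var_ideal_sigma b.
split; first split; first by apply/mideal_var.
- by move=> f g /mideal_var Vf /mideal_var Vg; apply/mideal_var/VD.
- by move=> f g /mideal_var Vg; apply/mideal_var/VM.
by move=> f /mideal_var Vf; apply/mideal_var/Vs.
Qed.

Lemma mideal_proper b : ~ mideal sigma b 1.
Proof. by move/mideal_var/var_ideal_proper. Qed.

Lemma mideal_prime b f g :
  mideal sigma b (f * g) -> mideal sigma b f \/ mideal sigma b g.
Proof. by move/mideal_var/var_ideal_prime=> -[] ?; [left|right]; apply/mideal_var. Qed.

Lemma mideal_well_mixed b : is_well_mixed sigma (mideal sigma b).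
Proof.
have [[_ _ PM] Ps] := mideal_sigma_ideal b.
move=> f g /mideal_prime[Pf|Pg]; last by apply: PM; apply: Ps.
by rewrite mulrC; apply: PM.
Qed.

Lemma mideal_radical b : is_radical (mideal sigma b).
Proof.
move=> f; elim=> [|e IHe]; first by move/mideal_proper.
by rewrite exprS => /mideal_prime[].
Qed.

(** * Intersections of the m^b and uniqueness *)

Lemma mideal_prod b (s : nat) (F : 'I_s -> dpoly k n) :
  mideal sigma b (\prod_t F t) -> exists t, mideal sigma b (F t).
Proof.
move=> PF; apply: NNPP => NP; move: PF.
apply: (big_ind (fun f => ~ mideal sigma b f)).
- exact: mideal_proper.
- by move=> f g Nf Ng /mideal_prime[].
by move=> t _ Pt; apply: NP; exists t.
Qed.

Lemma ideal_prod K (T : finType) (F : T -> dpoly k n) t :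
  is_ideal K -> K (F t) -> K (\prod_u F u).
Proof. by case=> _ _ KM Kt; rewrite (bigD1 t) //= mulrC; apply: KM. Qed.

(** Otherwise, multiply elements of the intersectands chosen outside the prime m^b. For [s = 0] the
    product is [1], excluded by properness. *)
Lemma mideal_mcap b (s : nat) (bs : 'I_s -> 'I_n -> option nat) :
  (forall f, mcap sigma bs f -> mideal sigma b f) ->
  exists t, forall f, mideal sigma (bs t) f -> mideal sigma b f.
Proof.
move=> sub; apply: NNPP => No.
have /fin_all_exists[F HF] : forall t, exists f,
    mideal sigma (bs t) f /\ ~ mideal sigma b f.
  move=> t; apply: NNPP => Nt; apply: No; exists t => f Pf.
  by apply: NNPP => Nf; apply: Nt; exists f.
have [|t] := @mideal_prod b s F; last exact: (HF t).2.
apply: sub => t; apply: (@ideal_prod _ _ F t) (HF t).1.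
exact: (mideal_sigma_ideal _).1.
Qed.

(** An intersectand of the first family contains one of the second, which contains one of the first;
    irredundancy makes the two outer ones coincide. *)
Lemma irredundant_decomposition_sub (s1 s2 : nat)
    (bs1 : 'I_s1 -> 'I_n -> option nat) (bs2 : 'I_s2 -> 'I_n -> option nat) :
  ideal_eq (mcap sigma bs1) (mcap sigma bs2) -> irredundant sigma bs1 ->
  forall t1, exists t2, ideal_eq (mideal sigma (bs1 t1)) (mideal sigma (bs2 t2)).
Proof.
move=> eq12 irr t1.
have [f /eq12|t2 sub2] := @mideal_mcap (bs1 t1) s2 bs2; first exact.
have [f /eq12|t1' sub1] := @mideal_mcap (bs2 t2) s1 bs1; first exact.
have t1'E : t1' = t1.
  apply/eqP; apply: contraT => ne; case: (irr t1) => f.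
  split=> [Pf t|Pf t _]; last exact: Pf.
  have [->|/Pf//] := eqVneq t t1.
  by apply: sub2; apply: sub1; apply: Pf.
by exists t2 => f; split=> [Pf|/sub2//]; apply: sub1; rewrite t1'E.
Qed.

(** * Heights of monomials *)

(** The shift by one reserves [0] for absence of y_i and matches [size (u i)], the height of y^u at
    [i]. *)
Definition mheight m (i : 'I_n) : nat :=
  (\max_(v <- finsupp m | v.1 == i) v.2.+1)%N.

Lemma mheightP m i c : (0 < c)%N ->
  reflect (exists2 t, (i, t) \in finsupp m & (c <= t.+1)%N) (c <= mheight m i)%N.
Proof.
move=> c_gt0; apply: (iffP idP) => [|[t tm ct]]; last first.
  apply: leq_trans ct _.
  exact: (@leq_bigmax_seq _ (finsupp m : seq (dvar n)) (fun v => v.1 == i)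
    (fun v => v.2.+1) (i, t) tm (eqxx i)).
rewrite leqNgt => ge_c; apply: NNPP => No; case/negP: ge_c.
rewrite -(prednK c_gt0) ltnS.
apply/bigmax_leqP_seq => -[i' t] tm /= /eqP ei.
rewrite -ltnS (prednK c_gt0) ltnNge; apply/negP => ct; apply: No.
by exists t; rewrite -?ei.
Qed.

Lemma mideal_mheight b m :
  mideal sigma b << m >> <-> exists i j, b i = Some j /\ (j < mheight m i)%N.
Proof.
split=> [/mideal_var/var_idealU/hasP[[i t] vm]|[i [j [bi /mheightP]]]].
  rewrite /bvar /=; case bi: (b i) => [j|] // jt; exists i, j; split=> //.
  by apply/mheightP => //; exists t.
case=> // t tm jt; apply/mideal_var/var_idealU/hasP; exists (i, t) => //.
by rewrite /bvar /= bi.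
Qed.

Lemma dmon_mideal b (u : 'I_n -> {poly nat}) i j :
  b i = Some j -> (j < size (u i))%N -> mideal sigma b (dmon sigma u).
Proof.
move=> bi ju; have [Pid _] := mideal_sigma_ideal b.
have [_ _ PM] := Pid.
rewrite /dmon; apply: (@ideal_prod _ _ _ i Pid).
(* The leading term of [u i] gives the factor of largest order, at least [j], with the nonzero
   leading coefficient as exponent. *)
have lt_last : ((size (u i)).-1 < size (u i))%N.
  by rewrite prednK // (leq_trans _ ju).
rewrite /dpow; apply: (@ideal_prod _ _ _ (Ordinal lt_last) Pid) => /=.
have : lead_coef (u i) != 0 by rewrite lead_coef_eq0 -size_poly_gt0 (leq_trans _ ju).
rewrite /lead_coef; case: (nth _ _ _) => // e _.
rewrite exprSr; apply: PM; apply/mideal_var; rewrite iter_dsig_dX add0n.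
by apply: var_ideal_dX bi _; rewrite -ltnS prednK // (leq_trans _ ju).
Qed.

(** * Monomials in radical well-mixed sigma-ideals *)

Section Membership.
Variables (K : dpoly k n -> Prop) (w : dpoly k n).
Hypotheses (Ksig : is_sigma_ideal sigma K) (Kwm : is_well_mixed sigma K).

(** Quantifying over the cofactor [a] makes this trade of [f] for a power of [w] stable under
    products. *)
Definition replaceable f := forall a, K (a * f) -> exists e, K (a * w ^+ e).

Lemma replaceable1 : replaceable 1.
Proof. by move=> a Ka; exists 0%N. Qed.

Lemma replaceableM f g : replaceable f -> replaceable g -> replaceable (f * g).
Proof.
move=> rf rg a; rewrite mulrA => /rg[e]; rewrite mulrAC => /rf[e'].
by rewrite -mulrA -exprD => Ka; exists (e + e')%N.
Qed.

Lemma replaceableX f e : replaceable f -> replaceable (f ^+ e).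
Proof.
move=> rf; elim: e => [|e IHe]; first by rewrite expr0; exact: replaceable1.
by rewrite exprS; apply: replaceableM.
Qed.

Lemma well_mixed_iter a f t : K (a * f) -> K (a * iter t (@dsig k sigma n) f).
Proof. by move=> Kaf; elim: t => [|t IHt]; [exact: Kaf | exact: Kwm IHt]. Qed.

Lemma replaceable_iter f g t : w = g * iter t (@dsig k sigma n) f -> replaceable f.
Proof.
move=> wE a /(well_mixed_iter t) Ka; exists 1%N; rewrite expr1 wE mulrCA.
by case: Ksig => -[_ _ KM] _; apply: KM.
Qed.

End Membership.

(** Every factor of y^u has a transform dividing [m], so y^u is traded for a power of [<< m >>];
    radicality removes the exponent. *)
Lemma rwm_monomial K (u : 'I_n -> {poly nat}) m :
  is_sigma_ideal sigma K -> is_well_mixed sigma K -> is_radical K ->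
  K (dmon sigma u) -> (forall i, (size (u i) <= mheight m i)%N) -> K << m >>.
Proof.
move=> Ksig Kwm Krad Ku um.
suff /(_ 1) [|e] : replaceable K << m >> (dmon sigma u).
- by rewrite mul1r.
- by rewrite mul1r => /Krad.
apply: big_ind => [||i _]; [exact: replaceable1 | exact: replaceableM |].
apply: big_ind => [||j _]; [exact: replaceable1 | exact: replaceableM |].
have ui_gt0 : (0 < size (u i))%N by apply: leq_ltn_trans (ltn_ord j).
(* Some sigma^t(y_i) occurs in [m] with [j < size (u i) <= t.+1], hence [j <= t]. *)
have /(mheightP _ _ ui_gt0)[t tm ut] := um i.
apply: replaceableX; apply: (replaceable_iter Ksig Kwm (t := t - j)).
rewrite !iter_dsig_dX add0n subnKC; first exact: malgU_divisible tm.
by rewrite -ltnS (leq_trans (ltn_ord j)).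
Qed.

End Difference.

Theorem theorem5p4 (k : fieldType) (sigma : {rmorphism k -> k})
    (char0 : [pchar k] =i pred0) (n : nat)
    (S : ('I_n -> {poly nat}) -> Prop) :
  let I := rwm_gen sigma (fun f => exists2 u, S u & f = dmon sigma u) in
  (exists (s : nat) (bs : 'I_s -> 'I_n -> option nat),
      ideal_eq I (mcap sigma bs)) /\
  (forall (s1 : nat) (bs1 : 'I_s1 -> 'I_n -> option nat)
          (s2 : nat) (bs2 : 'I_s2 -> 'I_n -> option nat),
      ideal_eq I (mcap sigma bs1) -> irredundant sigma bs1 ->
      ideal_eq I (mcap sigma bs2) -> irredundant sigma bs2 ->
      (forall t1, exists t2, ideal_eq (mideal sigma (bs1 t1)) (mideal sigma (bs2 t2))) /\
      (forall t2, exists t1, ideal_eq (mideal sigma (bs2 t2)) (mideal sigma (bs1 t1)))).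
Proof.
move=> I; split=> [|s1 bs1 s2 bs2 eq1 irr1 eq2 irr2]; last first.
  by split; apply: irredundant_decomposition_sub => // f;
    rewrite -eq1 -eq2.
(* The up-set is generated by the heights of the y^u. If [S] contains the zero exponent, this forces
   [s = 0], and the empty intersection is the whole ring. *)
have [s [bs [bsD Dbs]]] :=
  upset_decomposition (fun d : 'I_n -> nat => exists2 u, S u & d = fun i => size (u i)).
exists s, bs => f; split=> [If t|Pf K Ksig Kwm Krad KS].
  apply: If.
  - exact: mideal_sigma_ideal.
  - exact: mideal_well_mixed.
  - exact: mideal_radical.
  move=> _ [u Su ->].
  have [|i [j [bi ju]]] := bsD t (fun i => size (u i)); first by exists u.
  exact: dmon_mideal bi ju.
apply: ideal_msupp => [|m mf]; first exact: Ksig.1.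
(* Every intersectand contains [m], so its height meets every union of half-spaces and dominates the
   height of some y^u. *)
have [t|_ [u Su ->] um] := Dbs (mheight m).
  apply/(mideal_mheight sigma); apply/mideal_var/var_idealU.
  by have /mideal_var := Pf t; apply.
by apply: (rwm_monomial Ksig Kwm Krad _ um); apply: KS; exists u.
Qed.
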